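(* Let $k\ge 2$, let $\sigma$ be a request sequence over a set of pages $U$, let $\mathcal I$ be a $k$-level hierarchical service pattern for $\sigma$, and let $I\in\mathcal I$ be a level-$k$ interval. Let $Q\subseteq U$ be the set of feasible labels for $I$, i.e. the pages $p$ for which some labeling $\alpha$ of $T_I$ with $\alpha(I)=p$ is feasible for $\sigma_I$. Then either $Q=U$, or $|Q|\le n(k,1)$; moreover $n(k,1)\le 2^{2^{k+3\log_2 k}}$.
   Context: Let $U$ be a finite set of pages and $\sigma=\sigma_1,\dots,\sigma_T$ with $\sigma_t\in U$. A ($k$-level, hierarchical) service pattern is $\mathcal I=\mathcal I_1\cup\dots\cup\mathcal I_k$, where each $\mathcal I_i$ (the level-$i$ intervals) is a partition of $[0,T+1)$ into half-open intervals with integer endpoints, such that every level-$i$ interval with $i<k$ is contained in a level-$(i+1)$ interval. The ancestors $A(I)$ of $I$ are the higher-level intervals containing $I$; $T_I$ consists of $I$ and all lower-level intervals contained in $I$; the children of a level-$\ell$ interval are the level-$(\ell-1)$ intervals contained in it. A labeling is a partial map $\alpha$ from intervals to $U$; a labeling of a set $\mathcal J$ of intervals is feasible for $\sigma_I$ (the requests at times $t\in I\cap\{1,\dots,T\}$) if for every such $t$ some $J\in\mathcal J$ with $t\in J$ has $\alpha(J)=\sigma_t$. For a level-$\ell$ interval $I$ with $\ell\ge 2$ and set of children $C$, the joint request list $L(C)$ is the set of inclusion-minimal $S\subseteq U$ with $|S|\le k-\ell+1$ such that some labeling of $T_I\cup A(I)$, feasible for $\sigma_I$, labels each interval of $\{I\}\cup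 A(I)$ either not at all or by an element of $S$. $n(k,1)$ is the supremum, over all finite $U$, all request sequences, all $k$-level hierarchical service patterns and all level-$k$ intervals $I$, of the number of one-element sets in the joint request list of the children of $I$. *)

(* Defs.v *)
From HB Require Import structures.
From mathcomp Require Import all_boot all_order all_algebra.
From mathcomp Require Import boolp classical_sets reals ereal exp.

Set Implicit Arguments.
Unset Strict Implicit.
Unset Printing Implicit Defensive.

Import Order.TTheory GRing.Theory Num.Theory.

Local Open Scope nat_scope.

(* A half-open interval with integer endpoints inside [0, T + 1) is represented
   by the set of its integer points, a subset of 'I_T.+1 = {0, ..., T}. *)
Notation timeset T := {set 'I_T.+1}.

Definition hoint (T a b : nat) : timeset T := [set t : 'I_T.+1 | a <= t < b].

(* P i is the set of level-i intervals; only the levels 1 <= i <= k matter. *)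
Record service_pattern (k T : nat) (P : nat -> {set timeset T}) : Prop := {
  sp_interval : forall i J, 1 <= i <= k -> J \in P i ->
    exists a b : nat, a < b <= T.+1 /\ J = hoint T a b;
  sp_partition : forall i, 1 <= i <= k -> finset.partition (P i) [set: 'I_T.+1];
  sp_nested : forall i J, 1 <= i < k -> J \in P i ->
    exists2 J', J' \in P i.+1 & J \subset J'
}.

(* Intervals carry their level: the same set of times occurring at two levels
   gives two different intervals, which may be labeled differently. *)
Definition lvlint (T : nat) : Type := (nat * timeset T)%type.

Definition in_pattern (k T : nat) (P : nat -> {set timeset T}) (J : lvlint T)
    : Prop :=
  1 <= J.1 <= k /\ J.2 \in P J.1.

Definition ancestor (k T : nat) (P : nat -> {set timeset T}) (I J : lvlint T)
    : Prop :=
  [/\ in_pattern k P J, I.1 < J.1 & I.2 \subset J.2].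

(* The set T_I. *)
Definition subtree (k T : nat) (P : nat -> {set timeset T}) (I J : lvlint T)
    : Prop :=
  J = I \/ [/\ in_pattern k P J, J.1 < I.1 & J.2 \subset I.2].

(* A labeling of a set of intervals is given by a total function to option U;
   its values outside of that set are never consulted. *)
Definition labeling (T : nat) (U : finType) : Type := lvlint T -> option U.

(* sigma_t is tnth sigma i for t = i + 1, and lift ord0 i is the time i + 1 as
   an element of 'I_T.+1. *)
Definition feasible (T : nat) (U : finType) (sigma : T.-tuple U)
    (Js : lvlint T -> Prop) (I : timeset T) (alpha : labeling T U) : Prop :=
  forall i : 'I_T, lift ord0 i \in I ->
    exists J, [/\ Js J, lift ord0 i \in J.2 & alpha J = Some (tnth sigma i)].

Definition joint_candidate (k T : nat) (U : finType) (sigma : T.-tuple U)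
    (P : nat -> {set timeset T}) (I : lvlint T) (S : {set U}) : Prop :=
  #|S| <= k - I.1 + 1 /\
  exists alpha : labeling T U,
    feasible sigma (fun J => subtree k P I J \/ ancestor k P I J) I.2 alpha /\
    forall J, J = I \/ ancestor k P I J ->
      alpha J = None \/ exists2 p, p \in S & alpha J = Some p.

(* The joint request list L(C) of the set C of children of I; it is indexed by
   I itself, which is the union of its children. *)
Definition joint_request_list (k T : nat) (U : finType) (sigma : T.-tuple U)
    (P : nat -> {set timeset T}) (I : lvlint T) : {set {set U}} :=
  [set S : {set U} | minset (fun B => `[< joint_candidate k sigma P I B >]) S].

(* n(k, 1), a priori possibly +oo. *)
Definition n_k1 (R : realType) (k : nat) : \bar R :=
  ereal_sup [set x : \bar R |
    exists (U : finType) (T : nat) (sigma : T.-tuple U)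
           (P : nat -> {set timeset T}) (I : timeset T),
      [/\ service_pattern k P, I \in P k &
          x = (#|[set S in joint_request_list k sigma P (k, I) | #|S| == 1]%SET|%:R
               : R)%:E]]%classic.

(* The set Q of feasible labels of the level-k interval I. *)
Definition feasible_labels (k T : nat) (U : finType) (sigma : T.-tuple U)
    (P : nat -> {set timeset T}) (I : timeset T) : {set U} :=
  [set p : U | `[< exists alpha : labeling T U,
      alpha (k, I) = Some p /\ feasible sigma (subtree k P (k, I)) I alpha >]].

Definition log2 (R : realType) (x : R) : R := (ln x / ln 2)%R.

(* Main.v *)
(** For a level-[l] interval [I], let F(I) be the up-closed family of the sets [S]
    of pages such that the strict descendants of [I] can be labeled so that every
    request of [I] left unserved lies in [S]; the feasible labels of a level-[k]
    interval are the singletons of F(I). For [l = 1], F(I) consists of the supersets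
    of one set, and F(I) for [l + 1] is the intersection over the children [J] of
    the families {S | S + p in F(J) for some p}. The families are closed under
    contraction (S |-> W :|: S amounts to deleting the requests to W), so one may
    bound the number f_l(t) of minimal sets of size [t] in all contractions at once.
    A minimal set of the relaxed family arises by removing one page from a minimal
    set of F(J), and a minimal set of the intersection is built by satisfying an
    unsatisfied child first, whence
      f_(l+1)(t) <= \sum_(1 <= j <= t) (j + 1) f_l(j + 1) f_(l+1)(t - j).
    Since f_1 <= 1, this gives f_l(t) <= D_l ^ t for D_1 = 1, D_(l+1) = 4 D_l ^ 2,
    that is D_l = 2 ^ (2 ^ l - 2). *)

Require Import Defs.
From HB Require Import structures.
From mathcomp Require Import all_boot all_order all_algebra.
From mathcomp Require Import boolp classical_sets reals ereal exp.
From mathcomp Require Import fintype finset zify.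

Set Implicit Arguments.
Unset Strict Implicit.
Unset Printing Implicit Defensive.

Import Order.TTheory GRing.Theory Num.Theory.
Local Open Scope nat_scope.

Lemma leq_card_bigcup (I T : finType) (Q : pred I) (A : I -> {set T}) :
  #|\bigcup_(i | Q i) A i| <= \sum_(i | Q i) #|A i|.
Proof.
elim/big_ind2: _ => [|m X n Y leX leY|//]; first by rewrite cards0.
by rewrite (leq_trans (leq_card_setU X Y)) ?leq_add.
Qed.

(** * Counting minimal sets of up-closed families *)

Section MinimalSets.

Variable U : finType.
Implicit Types (F G : pred {set U}) (S W X Y Z : {set U}) (p : U) (t D A : nat).

Definition upclosed F := forall X Y, X \subset Y -> F X -> F Y.

Definition minsets F W t : {set {set U}} :=
  [set S | minset (fun B => F (W :|: B)) S & #|S| == t].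

(** The bound is uniform in [W] because the induction for intersections passes from [W] to
    [W :|: Y]. *)
Definition min_bounded F D := forall W t, #|minsets F W t| <= D ^ t.

Definition relax F : pred {set U} := fun S => F S || [exists p, F (p |: S)].

Lemma minsetsP F W t S :
  reflect [/\ F (W :|: S), forall B, F (W :|: B) -> B \subset S -> B = S & #|S| = t]
          (S \in minsets F W t).
Proof.
rewrite inE; apply: (iffP andP) => [[/minsetP[FS mS] /eqP cS]|[FS mS cS]] //.
by split; [apply/minsetP | apply/eqP].
Qed.

(** The only candidate for a minimal set after contraction by [W] is [X :\: W]. *)
Lemma min_bounded_above X : min_bounded (fun S => X \subset S) 1.
Proof.
move=> W t; rewrite exp1n -(cards1 (X :\: W)); apply/subset_leq_card/subsetP.
move=> S /minsetsP[FS mS _]; rewrite inE eq_sym; apply/eqP/mS.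
  by apply/subsetP => x Xx; rewrite !inE Xx; case: (x \in W).
by rewrite subDset.
Qed.

Lemma upclosed_relax F : upclosed F -> upclosed (relax F).
Proof.
move=> upF X Y sXY /orP[FX|/existsP[p Fp]]; apply/orP.
  by left; apply: upF FX.
by right; apply/existsP; exists p; apply: upF Fp; apply: setUS.
Qed.

Lemma card_minsets_relax F W t : upclosed F -> 0 < t ->
  #|minsets (relax F) W t| <= t.+1 * #|minsets F W t.+1|.
Proof.
move=> upF t_gt0.
pose R := \bigcup_(S in minsets F W t.+1) [set S :\ p | p in S].
apply: (@leq_trans #|R|); last first.
  apply: leq_trans (leq_card_bigcup _ _) _.
  rewrite mulnC -sum_nat_const; apply: leq_sum => S /minsetsP[_ _ cS].
  by rewrite -cS leq_imset_card.
apply/subset_leq_card/subsetP => S /minsetsP[GS mS cS].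
(* Otherwise some [q] in [S] could be removed and restored by the relaxation, against minimality;
   [0 < t] supplies [q]. *)
have notF : ~~ F (W :|: S).
  apply/negP => FS; have [q Sq] : exists q, q \in S.
    by apply/card_gt0P; rewrite cS.
  have /setP/(_ q) : S :\ q = S.
    apply: mS; last exact: subD1set.
    apply/orP; right; apply/existsP; exists q.
    by rewrite setUCA setD1K.
  by rewrite !inE eqxx Sq.
move: GS; rewrite /relax (negPf notF) /= => /existsP[p Fp].
rewrite setUCA in Fp.
have [S' minS' sS'] := @minset_exists _ (fun B => F (W :|: B)) _ Fp.
have [/= FS' mS'] := minsetP minS'.
have pS' : p \in S'.
  apply: contraNT notF => pS'; apply: upF FS'; apply: setUS.
  apply/subsetP => x xS'; move/subsetP/(_ x xS'): sS'.
  by rewrite !inE => /predU1P[xp|//]; rewrite -xp xS' in pS'.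
have eS : S' :\ p = S.
  apply: mS; last by rewrite subDset.
  by apply/orP; right; apply/existsP; exists p; rewrite setUCA setD1K.
apply/bigcupP; exists S'; last by apply/imsetP; exists p.
by apply/minsetsP; split=> //; rewrite (cardsD1 p) pS' eS cS.
Qed.

Lemma min_bounded_relax F D : upclosed F -> min_bounded F D ->
  forall W t, 0 < t -> #|minsets (relax F) W t| <= (2 * D ^ 2) ^ t.
Proof.
move=> upF bF W t t_gt0; apply: leq_trans (card_minsets_relax W upF t_gt0) _.
(* The two factors are bounded by [t.+1 <= 2 ^ t] and, as [0 < t], by [D ^ t.+1 <= D ^ (2 * t)]. *)
rewrite expnMn -expnM; apply: leq_mul; first exact: ltn_expl.
apply: leq_trans (bF W t.+1) _.
have [->|D_gt0] := posnP D; first by rewrite exp0n.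
by rewrite leq_pexp2l //; lia.
Qed.

Lemma min_bounded_forall (I : finType) (Q : pred I) (G : I -> pred {set U}) A :
  (forall i, Q i -> upclosed (G i)) ->
  (forall i, Q i -> forall W t, 0 < t -> #|minsets (G i) W t| <= A ^ t) ->
  min_bounded (fun S => [forall (i | Q i), G i S]) (2 * A).
Proof.
set F := (X in min_bounded X) => upG bG W t.
elim/ltn_ind: t W => t IHt W.
have [->|t_gt0] := posnP t.
  rewrite expn0 -(cards1 (set0 : {set U})); apply/subset_leq_card/subsetP.
  by move=> S /minsetsP[_ _ /cards0_eq ->]; rewrite inE.
have [FW|] := boolP (F W).
  rewrite (_ : minsets F W t = set0) ?cards0 //.
  apply/setP => S; rewrite [RHS]inE; apply/minsetsP => -[_ mS cS].
  by move: t_gt0; rewrite -cS -(mS set0) ?cards0 ?sub0set ?setU0.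
(* The index [i] depends on [W] alone, not on [S], so the count gets no factor for the number of
   families. *)
rewrite negb_forall => /existsP[i]; rewrite negb_imply => /andP[Qi nGW].
(* [Y] is a minimal set for [G i] inside [S]. It is nonempty because [G i W] fails, so its size is
   some [j.+1] and the induction covers [Z], the rest of [S]. *)
pose R (j : 'I_t) := \bigcup_(Y in minsets (G i) W j.+1)
   [set Y :|: Z | Z in minsets F (W :|: Y) (t - j.+1)].
apply: (@leq_trans #|\bigcup_(j : 'I_t) R j|).
  apply/subset_leq_card/subsetP => S /minsetsP[FS mS cS].
  have GS : G i (W :|: S) by move/forall_inP: (FS); apply.
  have [Y minY sY] := @minset_exists _ (fun B => G i (W :|: B)) _ GS.
  have [/= GY mY] := minsetP minY.
  have Y_gt0 : 0 < #|Y|.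
    by rewrite card_gt0; apply: contraNneq nGW => Y0; rewrite Y0 setU0 in GY.
  have cY : #|Y|.-1 < t by rewrite prednK // -cS subset_leq_card.
  apply/bigcupP; exists (Ordinal cY) => //; apply/bigcupP; exists Y.
    by apply/minsetsP; split=> //=; rewrite prednK.
  have eS : Y :|: S :\: Y = S by rewrite setDE setUIr setUCr setIT; apply/setUidPr.
  apply/imsetP; exists (S :\: Y) => //; apply/minsetsP; split.
  - by rewrite -setUA eS.
  - move=> B FB sB; have YB : Y :|: B = S.
      apply: mS; first by rewrite setUA.
      by rewrite subUset sY (subset_trans sB (subsetDl _ _)).
    apply/setP => x; rewrite -YB !inE; have [xB|] := boolP (x \in B).
      by move/subsetP/(_ x xB): sB; rewrite inE => /andP[-> _]; rewrite orbT.
    by rewrite orbF; case: (x \in Y).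
  - by rewrite cardsDS //= prednK // cS.
apply: leq_trans (leq_card_bigcup _ _) _.
apply: (@leq_trans (\sum_(j < t) A ^ t * 2 ^ (t - j.+1))).
  apply: leq_sum => j _; apply: leq_trans (leq_card_bigcup _ _) _.
  apply: (@leq_trans (\sum_(Y in minsets (G i) W j.+1) (2 * A) ^ (t - j.+1))).
    apply: leq_sum => Y _; apply: leq_trans (leq_imset_card _ _) _.
    by apply: IHt; have := ltn_ord j; lia.
  rewrite sum_nat_const; apply: leq_trans (leq_mul (bG i Qi W j.+1 isT) (leqnn _)) _.
  by rewrite expnMn mulnCA -expnD subnKC // mulnC.
(* What remains is the geometric sum with value [2 ^ t - 1]. *)
rewrite -big_distrr /= expnMn mulnC leq_mul //.
rewrite (reindex_inj rev_ord_inj) /=.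
rewrite (eq_bigr (fun j : 'I_t => 2 ^ j)); last first.
  by move=> j _; congr (_ ^ _); have := ltn_ord j; lia.
by have := predn_exp 2 t; rewrite mul1n => <-; apply: leq_pred.
Qed.

End MinimalSets.

(** * Residual families of the intervals of a service pattern *)

Section Patterns.

Variables (k T : nat) (U : finType) (sigma : T.-tuple U) (P : nat -> {set timeset T}).
Hypothesis patP : service_pattern k P.
Implicit Types (I J K : timeset T) (S : {set U}) (l : nat) (x : 'I_T.+1).

(* For [I] of level [l], this says that [S] belongs to the family F(I) of the header. *)
Definition served_with l I S : Prop :=
  exists alpha : labeling T U, forall i : 'I_T, lift ord0 i \in I ->
    tnth sigma i \in S \/
    exists J : lvlint T, [/\ in_pattern k P J, J.1 < l, J.2 \subset I,
      lift ord0 i \in J.2 & alpha J = Some (tnth sigma i)].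

Definition residual l I : pred {set U} := fun S => `[< served_with l I S >].

Lemma upclosed_residual l I : upclosed (residual l I).
Proof.
move=> X Y sXY /asboolP[alpha h]; apply/asboolP; exists alpha => i /h[iX|?].
  by left; apply: subsetP iX.
by right.
Qed.

Lemma pattern_uniq l I J x : 1 <= l <= k -> I \in P l -> J \in P l ->
  x \in I -> x \in J -> I = J.
Proof.
move=> /(sp_partition patP)/and3P[_ /trivIsetP tI _] PI PJ xI xJ.
apply/eqP/negP => /negP /(tI _ _ PI PJ) /pred0P/(_ x).
by rewrite /= xI xJ.
Qed.

Lemma pattern_cover l x : 1 <= l <= k -> exists2 J, J \in P l & x \in J.
Proof.
move=> /(sp_partition patP)/and3P[/eqP cP _ _].
by have : x \in cover (P l); [rewrite cP inE|move=> /bigcupP[J PJ xJ]; exists J].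
Qed.

Lemma pattern_nested l l' J : 1 <= l <= l' -> l' <= k -> J \in P l ->
  exists2 J', J' \in P l' & J \subset J'.
Proof.
case/andP=> l_gt0; elim: l' => [|l' IH]; first by case: l l_gt0.
rewrite leq_eqVlt => /predU1P[<-|ll'] lk PJ; first by exists J.
have [//||//|J' PJ' sJJ'] := IH; first exact: ltnW.
have [|J'' PJ'' sJ'] := sp_nested patP (i := l') (J := J') _ PJ'.
  by rewrite lk (leq_trans l_gt0).
by exists J'' => //; apply: subset_trans sJ'.
Qed.

Lemma pattern_sub l l' I J x : 1 <= l <= l' -> l' <= k -> J \in P l ->
  I \in P l' -> x \in J -> x \in I -> J \subset I.
Proof.
move=> ll' lk PJ PI xJ xI; have [I' PI' sJ] := pattern_nested ll' lk PJ.
suff -> : I = I' by [].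
apply: (pattern_uniq (l := l') (x := x)) => //; first by lia.
exact: subsetP xJ.
Qed.

Lemma residual1 I S :
  residual 1 I S =
  ([set tnth sigma i | i : 'I_T & lift ord0 i \in I] \subset S).
Proof.
apply/asboolP/subsetP => [[alpha h] _ /imsetP[i + ->]|sS].
  by rewrite inE => /h[//|[J [[/andP[J_gt0 _] _]]]]; rewrite ltnNge J_gt0.
exists (fun=> None) => i iI; left; apply: sS; apply/imsetP; exists i => //.
by rewrite inE.
Qed.

(** The children partition [I], so labelings below them are independent and can be glued; the page
    added by [relax] is the child's own label. *)
Lemma residualS l I S : 1 <= l < k -> I \in P l.+1 ->
  residual l.+1 I S =
  [forall (J | (J \in P l) && (J \subset I)), relax (residual l J) S].
Proof.
case/andP=> l_gt0 lk PI; have lk' : 1 <= l <= k by rewrite l_gt0 ltnW.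
apply/asboolP/forall_inP => [[alpha h] J /andP[PJ sJI]|h].
  (* [alpha] itself works below [J]: a level-[l] interval meeting [J] is [J], and a lower one
     meeting [J] lies inside it. *)
  have key S' : S \subset S' -> (forall p, alpha (l, J) = Some p -> p \in S') ->
      residual l J S'.
    move=> sS lab; apply/asboolP; exists alpha => i iJ.
    have [iS|] := h i (subsetP sJI _ iJ); first by left; apply: subsetP iS.
    case=> -[l' K] /= [[/= l'k PK] l'l sKI iK aK].
    have sKJ : K \subset J.
      by apply: (pattern_sub (l := l') (l' := l) (x := lift ord0 i)) => //; lia.
    move: l'l; rewrite ltnS leq_eqVlt => /predU1P[el|l'l].
      left; apply: lab; rewrite -aK; congr (alpha (_, _)) => //.
      apply: (pattern_uniq (l := l) (x := lift ord0 i)) => //.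
      by rewrite -el.
    by right; exists (l', K).
  apply/orP; case eJ: (alpha (l, J)) => [p|]; [right|left].
    apply/existsP; exists p; apply: key => [|q]; first exact: subsetUr.
    by rewrite eJ => -[->]; rewrite !inE eqxx.
  by apply: key => // p; rewrite eJ.
(* For each child, [f] selects a labeling below it together with its own label; other sets get a
   dummy value. *)
have /choice[f fP] J : exists ap : labeling T U * option U,
    J \in P l -> J \subset I -> forall i : 'I_T, lift ord0 i \in J ->
    tnth sigma i \in S \/ ap.2 = Some (tnth sigma i) \/
    exists K : lvlint T, [/\ in_pattern k P K, K.1 < l, K.2 \subset J,
      lift ord0 i \in K.2 & ap.1 K = Some (tnth sigma i)].
  have [/andP[PJ sJI]|nJ] := boolP ((J \in P l) && (J \subset I)); last first.
    by exists (fun=> None, None) => PJ sJI; rewrite PJ sJI in nJ.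
  have := h J; rewrite PJ sJI => /(_ isT) /orP[|/existsP[p]] /asboolP[alpha aP].
    by exists (alpha, None) => _ _ i /aP[?|?]; [left|right; right].
  exists (alpha, Some p) => _ _ i /aP[|?]; last by right; right.
  by rewrite !inE => /predU1P[->|?]; [right; left|left].
exists (fun K : lvlint T => if K.1 == l then (f K.2).2 else
  if [pick J in P l | K.2 \subset J] is Some J then (f J).1 K else None) => i iI.
have [J PJ iJ] := pattern_cover (lift ord0 i) lk'.
have sJI : J \subset I.
  by apply: (pattern_sub (l := l) (l' := l.+1) (x := lift ord0 i)) => //; lia.
have [?|[eJ|[K [KP Kl sKJ iK aK]]]] := fP J PJ sJI i iJ; first by left.
  by right; exists (l, J); split=> //=; rewrite eqxx.
right; exists K; split=> //; first exact: ltnW.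
  exact: subset_trans sJI.
rewrite ltn_eqF //; case: pickP => [J' /andP[PJ' sKJ']|/(_ J)]; last by rewrite PJ sKJ.
(* The picked interval is the right one, since [K] contains the time [i] and level-[l] intervals are
   disjoint. *)
suff -> : J' = J by [].
apply: (pattern_uniq (l := l) (x := lift ord0 i)) => //.
exact: subsetP iK.
Qed.

Lemma min_bounded_residual l I : 1 <= l <= k -> I \in P l ->
  min_bounded (residual l I) (2 ^ (2 ^ l - 2)).
Proof.
case/andP; elim: l I => // -[_|l IH] I _ lk PI.
  by rewrite (funext (residual1 I)); apply: min_bounded_above.
rewrite (funext (fun S => @residualS l.+1 I S lk PI)).
(* The inner factor 2 and the square come from [relax], the outer 2 from the intersection. *)
rewrite (_ : 2 ^ _ = 2 * (2 * (2 ^ (2 ^ l.+1 - 2)) ^ 2)).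
  apply: min_bounded_forall => J /andP[PJ _].
    exact/upclosed_relax/upclosed_residual.
  by apply: min_bounded_relax; [apply: upclosed_residual|apply: IH; rewrite // ltnW].
rewrite -expnM -!expnS; congr (_ ^ _).
have : 0 < 2 ^ l by rewrite expn_gt0.
by rewrite !expnS; lia.
Qed.

(** * Joint request lists and feasible labels at level [k] *)

Lemma joint_candidateE I S :
  joint_candidate k sigma P (k, I) S <-> #|S| <= 1 /\ residual k I S.
Proof.
rewrite /joint_candidate /= subnn add0n; split=> [[cS [alpha [fa la]]]|].
  split=> //; apply/asboolP; exists alpha => i iI.
  have [J [[[eJ|[JP Jk sJ]]|[[/andP[_ Jk] _] /= kJ _]] iJ aJ]] := fa i iI.
  - by left; have [|[p pS]] := la J (or_introl eJ); rewrite aJ // => -[->].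
  - by right; exists J.
  - by rewrite ltnNge Jk in kJ.
case=> cS /asboolP[alpha h]; split=> //.
exists (fun J : lvlint T => if J == (k, I) then [pick p in S] else alpha J); split.
  move=> i iI; have [iS|[J [JP Jk sJ iJ aJ]]] := h i iI.
    (* As [S] has at most one element, the picked label of [I] is the request itself. *)
    exists (k, I); split=> //; first by left; left.
    rewrite eqxx; case: pickP => [p pS|/(_ (tnth sigma i))]; last by rewrite iS.
    by congr Some; apply: (card_le1_eqP cS).
  exists J; split=> //; first by left; right.
  by case: eqP Jk => // ->; rewrite ltnn.
move=> J [->|[[/andP[_ Jk] _] /= kJ _]]; last by rewrite ltnNge Jk in kJ.
by rewrite eqxx; case: pickP => [p pS|]; [right; exists p|left].
Qed.

(** Subsets of a singleton all meet the size limit, so the limit does not affect minimality here. *)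
Lemma joint_request_list_singletons I :
  [set S in joint_request_list k sigma P (k, I) | #|S| == 1] =
  minsets (residual k I) set0 1.
Proof.
apply/setP => S; rewrite !inE; apply: andb_id2r => /eqP cS.
have eqC (B : {set U}) : #|B| <= 1 ->
      `[< joint_candidate k sigma P (k, I) B >] = residual k I (set0 :|: B).
  move=> cB; rewrite set0U; apply/asboolP/idP => [/joint_candidateE[]//|rB].
  exact/joint_candidateE.
have le1 (B : {set U}) : B \subset S -> #|B| <= 1.
  by rewrite -cS; apply: subset_leq_card.
apply/minsetP/minsetP => /= -[FS mS];
  (split; first by move: FS; rewrite eqC ?cS) => B FB sB;
  by apply: mS => //; move: FB; rewrite eqC // le1.
Qed.

Lemma feasible_labelsE I p :
  (p \in feasible_labels k sigma P I) = residual k I [set p].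
Proof.
rewrite inE; apply/asboolP/asboolP => -[alpha].
  case=> aI fa; exists alpha => i /fa[J [[->|[JP Jk sJ]] iJ aJ]].
    by left; move: aJ; rewrite aI => -[->]; rewrite inE.
  by right; exists J.
move=> h; exists (fun J : lvlint T => if J == (k, I) then Some p else alpha J).
rewrite eqxx; split=> // i iI.
have [|[J [JP Jk sJ iJ aJ]]] := h i iI.
  by rewrite inE => /eqP ->; exists (k, I); split=> //; [left|rewrite eqxx].
exists J; split=> //; first by right.
by case: eqP Jk => // ->; rewrite ltnn.
Qed.

(** If the empty set were in the family, every page would be feasible; hence each feasible singleton
    is minimal. *)
Lemma card_feasible_labels I : feasible_labels k sigma P I != [set: U] ->
  #|feasible_labels k sigma P I| <= #|minsets (residual k I) set0 1|.
Proof.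
move=> QT; have r0 : ~~ residual k I set0.
  apply: contraNN QT => r0; apply/eqP/setP => p; rewrite feasible_labelsE inE.
  by apply: upclosed_residual r0; apply: sub0set.
rewrite -(card_imset _ (@set1_inj U)); apply/subset_leq_card/subsetP.
move=> _ /imsetP[p + ->]; rewrite feasible_labelsE => rp.
apply/minsetsP; rewrite set0U cards1; split=> // B; rewrite set0U => rB.
by rewrite subset1 => /predU1P[//|/eqP B0]; rewrite B0 (negPf r0) in rB.
Qed.

End Patterns.

Theorem theorem5 (R : realType) (k T : nat) (U : finType) (sigma : T.-tuple U)
    (P : nat -> {set timeset T}) (I : timeset T) :
  2 <= k -> service_pattern k P -> I \in P k ->
  (feasible_labels k sigma P I = [set: U] \/
   ((#|feasible_labels k sigma P I|%:R : R)%:E <= n_k1 R k)%E) /\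
  (n_k1 R k <= (2 `^ (2 `^ (k%:R + 3 * log2 (k%:R : R))))%:E)%E.
Proof.
move=> k2 patP PI; split.
  have [->|QT] := eqVneq (feasible_labels k sigma P I) [set: U]; first by left.
  right; apply: (@le_trans _ _ (#|minsets (residual k sigma P k I) set0 1|%:R : R)%:E).
    by rewrite lee_fin ler_nat card_feasible_labels.
  apply: ereal_sup_ubound; exists U, T, sigma, P, I; split=> //.
  by rewrite joint_request_list_singletons.
apply: ge_ereal_sup => _ [U' [T' [sigma' [P' [I' [patP' PI' ->]]]]]].
rewrite joint_request_list_singletons lee_fin.
have k_gt0 : 0 < k by apply: ltnW.
(* Size [t = 1] gives at most [2 ^ (2 ^ k - 2)], and [3 * log2 k] is nonnegative. *)
apply: (@le_trans _ _ ((2 ^ (2 ^ k))%:R : R)%R).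
  rewrite ler_nat; apply: leq_trans (min_bounded_residual sigma' patP' _ PI' _ _) _.
    by rewrite k_gt0 leqnn.
  by rewrite expn1 leq_pexp2l // leq_subr.
rewrite natrX -powR_mulrn //; apply: ler_powR; first by rewrite ler1n.
rewrite natrX -powR_mulrn //; apply: ler_powR; first by rewrite ler1n.
by rewrite lerDl mulr_ge0 // divr_ge0 // ln_ge0 // ler1n.
Qed.
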